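(* For every $n\ge 1$, the row $\mathcal T_{n,*}=[\mathcal T_{n,1},\dots,\mathcal T_{n,n+1}]$ is the degree sequence of a multigraph without loops; that is, there is a finite multigraph (parallel edges allowed, no loops) on $n+1$ vertices $v_1,\dots,v_{n+1}$ in which $v_j$ has degree $\mathcal T_{n,j}$ for each $1\le j\le n+1$.
   Context: Define $\psi:\{1,2,3,\dots\}\to\{0,1,2,\dots\}$ by $\psi(1)=0$, $\psi(2)=1$, $\psi(3)=2$ and $\psi(j)=\sum_{k=1}^{j-1}\psi(k)$ for $j\ge 4$. The triangular array $\mathcal T=(\mathcal T_{n,j})$, $n\ge 0$, $1\le j\le n+1$, of integers is defined recursively by: $\mathcal T_{n,n+1}=1$ for every $n\ge 0$; $\mathcal T_{1,1}=1$, $\mathcal T_{2,2}=2$, $\mathcal T_{3,3}=3$; $\mathcal T_{n,n}=\sum_{k=1}^{n-2}\mathcal T_{n-k,n-k}$ for every $n\ge 4$; and $\mathcal T_{n,j}=\mathcal T_{n-1,j}+\psi(j)$ for every $n\ge 2$ and $1\le j\le n-1$. *)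

(* Defs.v *)
From mathcomp Require Import all_boot.

Set Implicit Arguments.
Unset Strict Implicit.
Unset Printing Implicit Defensive.

(* psi is given by course-of-values recursion: psi_list n is the list
   [:: psi 1; ...; psi n], and psi 0 is a junk value.  The lemmas below are
   the mathematical definition of psi. *)
Fixpoint psi_list (n : nat) : seq nat :=
  if n is m.+1 then
    let s := psi_list m in
    rcons s (match m with 0 => 0 | 1 => 1 | 2 => 2 | _ => sumn s end)
  else [::].

Definition psi (j : nat) : nat := last 0 (psi_list j).

(* Tdiag_list n is the list [:: T_{1,1}; ...; T_{n,n}].  For n >= 4 the sum of
   T_{n-k,n-k} over 1 <= k <= n-2 runs over T_{2,2}, ..., T_{n-1,n-1}, i.e. it
   omits T_{1,1}, which is why the head of the list is dropped. *)
Fixpoint Tdiag_list (n : nat) : seq nat :=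
  if n is m.+1 then
    let s := Tdiag_list m in
    rcons s (match m with 0 => 1 | 1 => 2 | 2 => 3 | _ => sumn (behead s) end)
  else [::].

(* T n j is the entry T_{n,j}; it is 0 outside the range 1 <= j <= n+1. *)
Fixpoint T (n j : nat) : nat :=
  if j == n.+1 then 1
  else if n is m.+1 then
    if j == n then last 0 (Tdiag_list n)
    else if 0 < j <= m then T m j + psi j
    else 0
  else 0.

Lemma psi1 : psi 1 = 0. Proof. by []. Qed.
Lemma psi2 : psi 2 = 1. Proof. by []. Qed.
Lemma psi3 : psi 3 = 2. Proof. by []. Qed.

Lemma psi_listE n : psi_list n = mkseq (fun i => psi i.+1) n.
Proof. by elim: n => // n IHn; rewrite mkseqS -IHn /psi /= last_rcons. Qed.

Lemma psi_rec j : 4 <= j -> psi j = \sum_(1 <= k < j) psi k.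
Proof.
case: j => [|[|[|[|j]]]] // _.
rewrite {1}/psi.
rewrite -[psi_list _]/(rcons (psi_list j.+3) (sumn (psi_list j.+3))).
by rewrite last_rcons psi_listE sumnE big_map big_add1 /index_iota subn0.
Qed.

Lemma T_last n : T n n.+1 = 1.
Proof. by case: n => [|n] //=; rewrite eqxx. Qed.

Lemma T_diagE n : T n.+1 n.+1 = last 0 (Tdiag_list n.+1).
Proof. by rewrite /= -[_ == n.+2]/(n == n.+1) ltn_eqF // eqxx. Qed.

Lemma T11 : T 1 1 = 1. Proof. by []. Qed.
Lemma T22 : T 2 2 = 2. Proof. by []. Qed.
Lemma T33 : T 3 3 = 3. Proof. by []. Qed.

Lemma Tdiag_listE n : Tdiag_list n = mkseq (fun i => T i.+1 i.+1) n.
Proof.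
by elim: n => // n IHn; rewrite mkseqS -IHn T_diagE /= last_rcons.
Qed.

Lemma T_diag_rec n :
  4 <= n -> T n n = \sum_(1 <= k < n.-1) T (n - k) (n - k).
Proof.
case: n => [|[|[|[|n]]]] // _; rewrite T_diagE.
rewrite -[Tdiag_list _]/(rcons (Tdiag_list n.+3)
                               (sumn (behead (Tdiag_list n.+3)))).
rewrite last_rcons Tdiag_listE /mkseq behead_map sumnE big_map big_nat_rev.
have -> : behead (iota 0 n.+3) = index_iota 1 n.+3 by rewrite /index_iota subn1.
apply: eq_big_nat => k /andP[_ lt_k].
by rewrite add1n subSS [n.+4.-1]/= subSn ?leq_subr // subKn // ltnW.
Qed.

Lemma T_rec n j : 2 <= n -> 1 <= j <= n.-1 -> T n j = T n.-1 j + psi j.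
Proof.
case: n => [|n] // _ /= j_in; have /andP[_ le_jn] := j_in.
by rewrite j_in !ltn_eqF // !ltnS // ltnW.
Qed.

(* A finite loopless multigraph: each edge has a set of exactly two endpoints,
   and distinct edges may have the same endpoints. *)
Record multigraph (V : finType) := Multigraph {
  edge : finType;
  ends : edge -> {set V};
  card_ends : forall e : edge, #|ends e| = 2
}.

Definition degree (V : finType) (G : multigraph V) (v : V) : nat :=
  #|[set e : edge G | v \in ends e]|.

(* Main.v *)
Require Import Defs.
From mathcomp Require Import all_boot.
From mathcomp Require Import zify.

(** The proof combines a realizability criterion with two facts about the
    rows of the array.

    Parallel edges make degree sequences easy to characterize: a function [f]
    on a finite set of vertices is the degree function of a loopless multigraph
    as soon as its sum is an even number [m.*2] and no value exceeds [m]
    ([degree_realizable]).  The graph is built greedily, by joining a vertex of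
    largest demand to a vertex of largest demand among the others.

    For the array, [psi] and the diagonal double from index 4 on, so that
    [psi j = 3 * 2 ^ (j - 4)] and [T n n = 5 * 2 ^ (n - 4)].  For [n >= 3],
    the increments received by columns 1 to [n] in passing from row [n] to row
    [n.+1] add up to [psi n.+1], and with the new diagonal entry to
    [(3 + 5) * 2 ^ (n - 3)], which is [2 ^ n]; the total is also [2 ^ n] for
    smaller [n].  Hence the row sum doubles at each step, and row [n] sums to
    [2 ^ n] ([sum_T_row]).  Since [psi j] is at most a quarter of [2 ^ j], no
    entry grows fast enough to exceed half of the row sum ([T_le_half]). *)

(** * Degree sequences of loopless multigraphs *)

Section AddEdge.

Variables (V : finType) (G : multigraph V) (u w : V).
Hypothesis neq_uw : u != w.

Definition add_edge_ends (e : option (edge G)) : {set V} :=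
  if e is Some e' then ends e' else [set u; w].

Lemma card_add_edge_ends e : #|add_edge_ends e| = 2.
Proof. by case: e => [e|] /=; rewrite ?card_ends // cards2 neq_uw. Qed.

Definition add_edge : multigraph V := Multigraph card_add_edge_ends.

Lemma degree_add_edge v :
  degree add_edge v = ((v == u) || (v == w)) + degree G v.
Proof.
rewrite /degree (cardsD1 None) !inE /=; congr (_ + _).
have injS : injective (@Some (edge G)) by move=> e e' [].
rewrite -(card_imset _ injS); apply: eq_card => -[e|].
  by rewrite (mem_imset _ _ injS) !inE.
by rewrite !inE; apply/esym/imsetP => -[].
Qed.

End AddEdge.

Lemma degree_zero_realizable (V : finType) :
  exists G : multigraph V, forall v, degree G v = 0.
Proof.
have card_void_ends (e : void) : #|of_void {set V} e| = 2 by case: e.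
exists (Multigraph card_void_ends) => v.
by apply: eq_card0 => -[].
Qed.

(** After one unit is removed from the largest demand [f u] and from the
    largest remaining demand [f w], the bound still holds at a third vertex [v]:
    if [f v = m.+1], then [f u] and [f w] are at least [m.+1] too, and the three
    together exceed the total [m.+1.*2]. *)
Lemma degree_realizable (V : finType) (m : nat) (f : V -> nat) :
    \sum_v f v = m.*2 -> (forall v, f v <= m) ->
  exists G : multigraph V, forall v, degree G v = f v.
Proof.
elim: m f => [|m IHm] f sum_f le_f.
  have [G degG] := degree_zero_realizable V.
  by exists G => v; rewrite degG; apply/esym/eqP; rewrite -leqn0.
have [v0 _ _] : exists2 v, true & 0 < f v.
  apply/exists_inP; apply: contraTT isT => /exists_inPn f0.
  by move: sum_f; rewrite big1 // => v _; apply/eqP; rewrite -leqn0 leqNgt f0.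
have [u _ max_u] := @arg_maxnP _ v0 predT f isT.
have sum_u : f u + \sum_(v | v != u) f v = m.+1.*2.
  by rewrite -sum_f [RHS](bigD1 u).
have [w0 neq_w0u _] : exists2 v, v != u & 0 < f v.
  apply/exists_inP; apply: contraTT isT => /exists_inPn f0.
  move: sum_u (le_f u); rewrite big1 => [|v /f0]; last by lia.
  by lia.
have [w neq_wu max_w] := @arg_maxnP _ w0 (fun v => v != u) f neq_w0u.
have sum_uw : f u + (f w + \sum_(v | (v != u) && (v != w)) f v) = m.+1.*2.
  by rewrite -sum_u [in RHS](bigD1 w).
have fw_gt0 : 0 < f w.
  have [fw0|//] := posnP (f w).
  move: sum_u (le_f u); rewrite big1 => [|v /max_w]; last by lia.
  by lia.
have fu_gt0 : 0 < f u by apply: leq_trans fw_gt0 (max_u w isT).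
pose g v := f v - ((v == u) || (v == w)).
have gE v : v != u -> v != w -> g v = f v.
  by rewrite /g => /negPf-> /negPf->; rewrite subn0.
have gu : g u = (f u).-1 by rewrite /g eqxx subn1.
have gw : g w = (f w).-1 by rewrite /g eqxx orbT subn1.
have sum_g : \sum_v g v = m.*2.
  rewrite (bigD1 u) //= (bigD1 w) //= gu gw.
  rewrite (eq_bigr f) => [|v /andP[vu vw]]; last exact: gE.
  by lia.
have le_g v : g v <= m.
  have [->|vu] := eqVneq v u; first by rewrite gu; have := le_f u; lia.
  have [->|vw] := eqVneq v w; first by rewrite gw; have := le_f w; lia.
  rewrite gE //; have := max_u w isT; have := max_w v vu; move: sum_uw.
  by rewrite (bigD1 v) /= ?vu ?vw //; lia.
have [G degG] := IHm g sum_g le_g.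
have neq_uw : u != w by rewrite eq_sym.
exists (add_edge V G u w neq_uw) => v; rewrite degree_add_edge degG.
have [->|vu] := eqVneq v u; first by rewrite gu; lia.
have [->|vw] := eqVneq v w; first by rewrite gw; lia.
by rewrite gE.
Qed.

(** * Row sums and the largest entry of a row *)

Lemma psi_closed k : psi k.+4 = 3 * 2 ^ k.
Proof.
elim: k => [//|k IHk].
by rewrite psi_rec // big_nat_recr //= -psi_rec // IHk expnS; lia.
Qed.

Lemma T_diag_closed k : T k.+4 k.+4 = 5 * 2 ^ k.
Proof.
elim: k => [//|k IHk].
rewrite T_diag_rec // [k.+4.+1.-1]/= big_nat_recl // subn1.
under eq_bigr do rewrite subSS.
by rewrite -[k.+3]/(k.+4.-1) -T_diag_rec // IHk expnS; lia.
Qed.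

Lemma psi_le_quarter j : 0 < j -> 4 * psi j <= 2 ^ j.
Proof.
case: j => [|[|[|[|k]]]] // _.
by rewrite psi_closed !expnS; lia.
Qed.

Lemma T_diag_le_half n : 0 < n -> 2 * T n n <= 2 ^ n.
Proof.
case: n => [|[|[|[|k]]]] // _.
by rewrite T_diag_closed !expnS; lia.
Qed.

(** The left-hand side is the amount by which row [n.+1] exceeds row [n]: the
    final entry 1 of row [n] reappears, one place further, in row [n.+1]. *)
Lemma sum_psi_T_diag n :
  \sum_(i < n) psi i.+1 + T n.+1 n.+1 = 2 ^ n.
Proof.
case: n => [|[|[|k]]]; try by rewrite ?big_ord_recr big_ord0.
have -> : \sum_(i < k.+3) psi i.+1 = psi k.+4.
  by rewrite psi_rec // big_add1 big_mkord.
by rewrite psi_closed T_diag_closed !expnS; lia.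
Qed.

Lemma sum_T_row n : \sum_(i < n.+1) T n i.+1 = 2 ^ n.
Proof.
elim: n => [|n IHn]; first by rewrite big_ord1.
rewrite big_ord_recr big_ord_recr T_last.
rewrite (eq_bigr (fun i : 'I_n => T n i.+1 + psi i.+1)); last first.
  by case=> i lt_in _; rewrite T_rec //=; lia.
rewrite big_split; move: IHn (sum_psi_T_diag n).
by rewrite big_ord_recr T_last expnS /=; lia.
Qed.

(** From row [n] to row [n.+1], half of the row sum grows by [2 ^ n.-1], while
    an entry in a column [j <= n] gains only [psi j], at most a quarter of
    [2 ^ n]. *)
Lemma T_le_half n j : 0 < n -> 0 < j <= n.+1 -> 2 * T n j <= 2 ^ n.
Proof.
elim: n => [//|n IHn] _ /andP[j_gt0 le_jn].
have [->|ne_j] := eqVneq j n.+2; first by rewrite T_last expnS; lia.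
have [->|ne_j'] := eqVneq j n.+1; first exact: T_diag_le_half.
have le_j : j <= n by lia.
rewrite T_rec /=; [|lia|lia].
have := psi_le_quarter j j_gt0; have := IHn ltac:(lia) ltac:(lia).
have := @leq_pexp2l 2 j n isT le_j.
by rewrite expnS; lia.
Qed.

Theorem corollary2p12 (n : nat) (hn : 1 <= n) :
  exists G : multigraph 'I_n.+1, forall j : 'I_n.+1, degree G j = T n j.+1.
Proof.
have pow_n : 2 ^ n = (2 ^ n.-1).*2 by rewrite -mul2n -expnS prednK.
apply: (@degree_realizable _ (2 ^ n.-1)) => [|j]; first by rewrite sum_T_row.
by rewrite -leq_double -pow_n -mul2n T_le_half // ltn_ord.
Qed.
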